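(* The natural surjection $\eta:\pi_0^{\mathrm{Crs}}(-)\twoheadrightarrow\mathcal{E}\mathrm{nds}(-)$ of functors $\mathbf{PGeo}^{\mathrm{Crs}}\to\mathbf{Set}$, with components $\eta_X([\alpha]_0^{\mathrm{Crs}})=\mathrm{end}(\alpha^* )$, is not a natural injection; i.e. there is a proper geodesic metric space $X$ for which $\eta_X:\pi_0^{\mathrm{Crs}}(X)\to\mathcal{E}\mathrm{nds}(X)$ is not injective.
   Context: A metric space is proper if its closed bounded subsets are exactly its compact subsets. A metric space $X$ is geodesic if any $x,x'\in X$ are joined by a geodesic, i.e. an isometric embedding $u_{x,x'}:[0,a_{x,x'}]\to X$ with $a_{x,x'}=d_X(x,x')$, $u_{x,x'}(0)=x$, $u_{x,x'}(a_{x,x'})=x'$. A map $f:X\to Y$ of metric spaces is controlled if for every $R>0$ there is $S>0$ such that $d_X(x,x')<R$ implies $d_Y(f(x),f(x'))<S$; (metrically) proper if preimages of bounded sets are bounded; coarse if both. $\mathbf{PGeo}^{\mathrm{Crs}}$ is the category of proper geodesic metric spaces and coarse maps. For proper $X$, two metrically proper continuous maps $r,r':\mathbb{R}_{\ge0}\to X$ are equivalent if for every bounded $B\subseteq X$ there is $t\ge0$ such that $r([t,\infty))$ and $r'([t,\infty))$ lie in the same path component of $X\setminus B$. $\mathcal{E}\mathrm{nds}(X)$ is the set of classes $\mathrm{end}(r)$. For a map $r:\mathbb{R}_{\ge0}\to X$ to a geodesic space, $r^*(h)=u_{r(\lfloor h\rfloor),r(\lceil h\rceil)}\big(a_{r(\lfloor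 h\rfloor),r(\lceil h\rceil)}(h-\lfloor h\rfloor)\big)$ for some choice of geodesics; if $r$ is coarse then $r^*$ is a proper Lipschitz ray close to $r$. On a coarse map $f$, $\mathcal{E}\mathrm{nds}$ acts by $\mathrm{end}(r)\mapsto\mathrm{end}((f\circ r)^* )$ with $r$ a geodesic ray (isometric embedding of $\mathbb{R}_{\ge0}$) representing the end. For a coarse map $q:X\to\mathbb{R}_{\ge0}$, let $I_qX=\{(x,t)\in X\times\mathbb{R}_{\ge0}:t\le q(x)\}$ with the restriction of the max product metric. Coarse maps $f,g:X\to Y$ are coarse homotopic if there are coarse maps $q:X\to\mathbb{R}_{\ge0}$ and $H:I_qX\to Y$ with $H(x,0)=f(x)$, $H(x,q(x))=g(x)$; this is an equivalence relation. $\pi_0^{\mathrm{Crs}}(X)$ is the set of coarse homotopy classes $[\alpha]_0^{\mathrm{Crs}}$ of coarse maps $\alpha:\mathbb{R}_{\ge0}\to X$; a coarse map $f$ acts by $[\alpha]_0^{\mathrm{Crs}}\mapsto[f\circ\alpha]_0^{\mathrm{Crs}}$. It is known that the maps $\eta_X$ above are well defined, surjective and natural. *)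

(* Defs.v *)
From HB Require Import structures.
From mathcomp Require Import all_boot all_order all_algebra generic_quotient.
From mathcomp Require Import lra.
From mathcomp Require Import all_classical all_reals topology metric_structure.

Set Implicit Arguments.
Unset Strict Implicit.
Unset Printing Implicit Defensive.

Import Order.TTheory GRing.Theory Num.Theory.
Import numFieldTopology.Exports.
Import metricType_numDomainType.

Local Open Scope classical_set_scope.
Local Open Scope ring_scope.

(* Products carry the max metric and subsets the restricted metric; both induce
   the library's existing topologies on products and on [set_type]. *)
Section prod_metric.
Context {R : realType} {X Y : metricType R}.

Let dist (p q : X * Y) : R := Num.max (mdist p.1 q.1) (mdist p.2 q.2).

Let dist_ge0 p q : 0 <= dist p q.
Proof. by rewrite /dist le_max mdist_ge0. Qed.

Let dist_positivity p q : dist p q = 0 -> p = q.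
Proof.
move=> pq0; have := lexx (dist p q); rewrite {2}pq0 /dist ge_max => /andP[p1 p2].
case: p q p1 p2 {pq0} => [x y] [x' y'] /= p1 p2.
by congr pair; apply: mdist_positivity; apply/eqP;
  rewrite eq_le mdist_ge0 andbT.
Qed.

Let ballE p d : ball p d = [set q | dist p q < d].
Proof.
apply/seteqP; split => q /=; rewrite /dist gt_max.
  by case; rewrite !ballEmdist/= => -> ->.
by move=> /andP[? ?]; split; rewrite ballEmdist.
Qed.

HB.instance Definition _ :=
  @PseudoMetric_isMetric.Build R (X * Y)%type dist dist_ge0 dist_positivity ballE.

End prod_metric.

Section subset_metric.
Context {R : realType} {X : metricType R} (A : set X).

Let dist (x y : A) : R := mdist (\val x) (\val y).

Let dist_ge0 x y : 0 <= dist x y.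
Proof. exact: mdist_ge0. Qed.

Let dist_positivity x y : dist x y = 0 -> x = y.
Proof. by move=> /mdist_positivity /val_inj. Qed.

Let ballE x d : ball x d = [set y | dist x y < d].
Proof. by rewrite -initial_ballE ballEmdist. Qed.

HB.instance Definition _ :=
  @PseudoMetric_isMetric.Build R (set_type A) dist dist_ge0 dist_positivity ballE.

End subset_metric.

Section coarse_geometry.
Context {R : realType}.

Definition mbounded (X : metricType R) (A : set X) : Prop :=
  exists M : R, forall x y, A x -> A y -> mdist x y <= M.

Definition proper_space (X : metricType R) : Prop :=
  forall A : set X, closed A /\ mbounded A <-> compact A.

(* Only the values of [u] on [0, mdist x y] are relevant. *)
Definition is_geodesic (X : metricType R) (x y : X) (u : R -> X) : Prop :=
  [/\ u 0 = x, u (mdist x y) = y &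
      {in `[0, mdist x y] &, forall s t, mdist (u s) (u t) = `|s - t|}].

Definition geodesic_space (X : metricType R) : Prop :=
  forall x y : X, exists u, is_geodesic x y u.

Definition controlled (X Y : metricType R) (f : X -> Y) : Prop :=
  forall r : R, 0 < r -> exists2 s : R, 0 < s &
    forall x x', mdist x x' < r -> mdist (f x) (f x') < s.

Definition metrically_proper (X Y : metricType R) (f : X -> Y) : Prop :=
  forall B : set Y, mbounded B -> mbounded (f @^-1` B).

Definition coarse (X Y : metricType R) (f : X -> Y) : Prop :=
  controlled f /\ metrically_proper f.

End coarse_geometry.

Record pgeo (R : realType) := PGeo {
  pgeo_space :> metricType R ;
  pgeo_proper : proper_space pgeo_space ;
  pgeo_geodesic : geodesic_space pgeo_space }.

Record coarse_map (R : realType) (X Y : metricType R) := CoarseMap {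
  coarse_fun :> X -> Y ;
  coarse_mapP : coarse coarse_fun }.

HB.instance Definition _ (R : realType) (X Y : metricType R) :=
  gen_eqMixin (coarse_map X Y).
HB.instance Definition _ (R : realType) (X Y : metricType R) :=
  gen_choiceMixin (coarse_map X Y).

Definition nonneg_set (R : realType) : set R^o := [set t : R^o | 0 <= (t : R)].

Definition halfline (R : realType) : metricType R := set_type (@nonneg_set R).

Section halfline.
Context {R : realType}.

Definition hval (t : halfline R) : R := \val t.

Lemma to_halfline_subproof (t : R) : (Num.max 0 t : R^o) \in @nonneg_set R.
Proof. by apply/mem_set; rewrite /nonneg_set/= le_max lexx. Qed.

(* The retraction of the line onto the half-line, used to view a nonnegative
   real number as a point of [halfline R]. *)
Definition to_halfline (t : R) : halfline R :=
  exist _ (Num.max 0 t : R^o) (to_halfline_subproof t).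

Lemma hval_ge0 t : 0 <= hval t.
Proof. by rewrite /hval; case: t => t /= /set_mem. Qed.

Lemma hval_inj : injective hval.
Proof. exact: val_inj. Qed.

Lemma to_halflineK t : 0 <= t -> hval (to_halfline t) = t.
Proof. by move=> t0; rewrite /hval/=; apply/max_idPr. Qed.

Lemma hvalK t : to_halfline (hval t) = t.
Proof. by apply: hval_inj; rewrite to_halflineK ?hval_ge0. Qed.

Lemma halfline_dist s t : mdist s t = `|hval s - hval t|.
Proof. by rewrite distrC. Qed.

End halfline.

Section interpolation.
Context {R : realType} {X : metricType R}.

(* [star u r] is the ray r^* obtained from [r] by joining its values at
   consecutive integers by the geodesics [u]. *)
Definition star (u : X -> X -> R -> X) (r : halfline R -> X)
    (h : halfline R) : X :=
  let lo := (Num.floor (hval h))%:~R : R in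
  let x := r (to_halfline lo) in
  let y := r (to_halfline (Num.ceil (hval h))%:~R) in
  u x y (mdist x y * (hval h - lo)).

End interpolation.

(* A fixed choice of geodesics; by [end_star_choice] the end of [star u r] does
   not depend on it. *)
Definition geod (R : realType) (X : pgeo R) (x y : X) : R -> X :=
  sval (cid (pgeo_geodesic x y)).

Section coarse_homotopy.
Context {R : realType}.

Definition cylinder_set (X : metricType R) (q : X -> halfline R) :
  set (X * halfline R) := [set p | hval p.2 <= hval (q p.1)].

Definition cylinder (X : metricType R) (q : X -> halfline R) : metricType R :=
  set_type (cylinder_set q).

Lemma cyl_subproof (X : metricType R) (q : X -> halfline R) (x : X) (t : R) :
  (x, to_halfline (Num.min t (hval (q x)))) \in cylinder_set q.
Proof.
apply/mem_set; rewrite /cylinder_set/= {1}/hval/= ge_max hval_ge0/=.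
by rewrite ge_min lexx orbT.
Qed.

(* The point (x, t) of the cylinder; [t] is truncated to [0, q x]. *)
Definition cyl (X : metricType R) (q : X -> halfline R) (x : X) (t : R) :
  cylinder q :=
  exist _ (x, to_halfline (Num.min t (hval (q x)))) (cyl_subproof q x t).

Definition coarse_homotopic (X Y : metricType R) (f g : X -> Y) : Prop :=
  exists q : X -> halfline R, coarse q /\
  exists H : cylinder q -> Y, coarse H /\
    forall x, H (cyl q x 0) = f x /\ H (cyl q x (hval (q x))) = g x.

End coarse_homotopy.

Section ends.
Context {R : realType} {X : metricType R}.

Definition path_joined (A : set X) (x y : X) : Prop :=
  exists g : R -> X, [/\ {within `[0, 1], continuous g}, g 0 = x, g 1 = y &
    g @` `[0, 1] `<=` A].

Definition path_component (A : set X) (x : X) : set X :=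
  [set y | path_joined A x y].

Definition end_equiv (r r' : halfline R -> X) : Prop :=
  forall B : set X, mbounded B -> exists (t : halfline R) (x : X),
    [/\ (~` B) x,
        r @` [set s | hval t <= hval s] `<=` path_component (~` B) x &
        r' @` [set s | hval t <= hval s] `<=` path_component (~` B) x].

End ends.

Record proper_ray (R : realType) (X : metricType R) := ProperRay {
  ray_fun :> halfline R -> X ;
  ray_continuous : continuous ray_fun ;
  ray_proper : metrically_proper ray_fun }.

HB.instance Definition _ (R : realType) (X : metricType R) :=
  gen_eqMixin (proper_ray X).
HB.instance Definition _ (R : realType) (X : metricType R) :=
  gen_choiceMixin (proper_ray X).

Section metric_facts.
Context {R : realType}.

Lemma continuous_mdistP (X Y : metricType R) (f : X -> Y) :
  continuous f <-> forall x (e : R), 0 < e -> exists2 d : R, 0 < d &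
    forall y, mdist x y < d -> mdist (f x) (f y) < e.
Proof.
split=> [cf x e e0|H x].
  have /cvgrPdist_lt/(_ e e0)/nbhs_mdistP[d /= d0 dH] := cf x.
  by exists d.
apply/cvgrPdist_lt => e /(H x)[d d0 dH].
by apply/nbhs_mdistP; exists d.
Qed.

Lemma within_mdistP (X : metricType R) (A : set R) (g : R -> X) :
  {within A, continuous g} <->
  forall x e : R, A x -> 0 < e -> exists2 d : R, 0 < d &
    forall y, A y -> `|x - y| < d -> mdist (g x) (g y) < e.
Proof.
rewrite (@subspace_sigL_continuousP R^o A X g).
rewrite (@continuous_mdistP (set_type (A : set R^o)) X).
split=> [H x e Ax e0|H x e e0].
  have [d d0 dH] := H (exist _ x (mem_set Ax)) e e0.
  exists d => // y Ay xy; have /= := dH (exist _ y (mem_set Ay)).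
  by apply; rewrite /mdist/= /mdist/= distrC.
have [d d0 dH] := H (\val x) e (set_mem (valP x)) e0.
exists d => // y xy; apply: dH; first exact: set_mem (valP y).
by move: xy; rewrite /mdist/= /mdist/= distrC.
Qed.

Lemma mboundedP (X : metricType R) (x0 : X) (A : set X) :
  mbounded A <-> exists M, forall x, A x -> mdist x0 x <= M.
Proof.
split=> [[M HM]|[M HM]].
  have [[a Aa]|A0] := pselect (exists a, A a).
    exists (mdist x0 a + M) => x Ax.
    by rewrite (le_trans (metric_triangle _ a _))// lerD2l HM.
  by exists 0 => x Ax; exfalso; apply: A0; exists x.
exists (M + M) => x y Ax Ay.
by rewrite (le_trans (metric_triangle _ x0 _))// lerD ?HM// metric_sym HM.
Qed.

Lemma mbounded_halfline (A : set (halfline R)) :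
  mbounded A <-> exists M, forall t, A t -> hval t <= M.
Proof.
rewrite (mboundedP (to_halfline 0)).
have E t : mdist (to_halfline 0) t = hval t.
  by rewrite halfline_dist to_halflineK// sub0r normrN ger0_norm// hval_ge0.
by split=> -[M HM]; exists M => t /HM; rewrite E.
Qed.

End metric_facts.

Section paths.
Context {R : realType} {X : metricType R} (A : set X).

Lemma path_joined_refl x : A x -> path_joined A x x.
Proof.
move=> Ax; exists (fun=> x); split => //.
  by apply/within_mdistP => s e _ e0; exists 1 => // *; rewrite mdistxx.
by move=> _ [t _ <-].
Qed.

Lemma path_joined_sym x y : path_joined A x y -> path_joined A y x.
Proof.
move=> [g [/within_mdistP gc g0 g1 gA]]; exists (fun t => g (1 - t)).
have I01 (t : R) : `[0, 1]%classic t -> `[0, 1]%classic (1 - t).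
  by rewrite /= !in_itv/= => /andP[? ?]; apply/andP; split; lra.
split; rewrite ?subr0 ?subrr//.
  apply/within_mdistP => s e /I01 s01 /(gc _ _ s01)[d d0 dH].
  exists d => // t /I01 t01 st; apply: dH => //.
  by rewrite (_ : _ - _ = t - s) 1?distrC//; lra.
by move=> _ [t /I01 t01 <-]; apply: gA; exists (1 - t).
Qed.

Lemma path_joined_trans x y z :
  path_joined A x y -> path_joined A y z -> path_joined A x z.
Proof.
move=> [f [/within_mdistP fc f0 f1 fA]] [g [/within_mdistP gc g0 g1 gA]].
pose k (t : R) := if t <= 1 / 2 then f (2 * t) else g (2 * t - 1).
have kE1 (t : R) : t <= 1 / 2 -> k t = f (2 * t) by rewrite /k => ->.
have kE2 (t : R) : 1 / 2 <= t -> k t = g (2 * t - 1).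
  rewrite /k le_eqVlt => /predU1P[<-|]; last by move=> h; rewrite leNgt h.
  by rewrite lexx (_ : 2 * _ = 1) ?f1 ?subrr ?g0//; lra.
have L (t : R) : 0 <= t -> t <= 1 / 2 -> `[0, 1]%classic (2 * t).
  by move=> *; rewrite /= in_itv/=; apply/andP; split; lra.
have U (t : R) : 1 / 2 <= t -> t <= 1 -> `[0, 1]%classic (2 * t - 1).
  by move=> *; rewrite /= in_itv/=; apply/andP; split; lra.
exists k; split.
- apply/within_mdistP => s e; rewrite /= in_itv/= => /andP[s0 s1] e0.
  have [sh|sh|sh] := ltgtP s (1 / 2).
  + have [d d0 dH] := fc (2 * s) e (L _ s0 (ltW sh)) e0.
    exists (Num.min (d / 2) (1 / 2 - s)).
      by rewrite lt_min; apply/andP; split; lra.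
    move=> t; rewrite in_itv/= => /andP[t0 t1]; rewrite lt_min => /andP[a b].
    have th : t <= 1 / 2 by move: b; rewrite ltr_norml => /andP[]; lra.
    rewrite !kE1 ?(ltW sh)//; apply: dH; first exact: L.
    by rewrite -mulrBr normrM ger0_norm//; lra.
  + have [d d0 dH] := gc (2 * s - 1) e (U _ (ltW sh) s1) e0.
    exists (Num.min (d / 2) (s - 1 / 2)).
      by rewrite lt_min; apply/andP; split; lra.
    move=> t; rewrite in_itv/= => /andP[t0 t1]; rewrite lt_min => /andP[a b].
    have th : 1 / 2 <= t by move: b; rewrite ltr_norml => /andP[]; lra.
    rewrite !kE2 ?(ltW sh)//; apply: dH; first exact: U.
    rewrite (_ : _ - _ = 2 * (s - t)); last by lra.
    by rewrite normrM ger0_norm//; lra.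
  + have sh1 : s <= 1 / 2 by rewrite sh.
    have sh2 : 1 / 2 <= s by rewrite sh.
    have [d d0 dH] := gc (2 * s - 1) e (U _ sh2 s1) e0.
    have [d' d'0 d'H] := fc (2 * s) e (L _ s0 sh1) e0.
    exists (Num.min (d / 2) (d' / 2)).
      by rewrite lt_min; apply/andP; split; lra.
    move=> t; rewrite in_itv/= => /andP[t0 t1]; rewrite lt_min => /andP[a b].
    have [th|/ltW th] := leP t (1 / 2).
      rewrite !kE1//; apply: d'H; first exact: L.
      by rewrite -mulrBr normrM ger0_norm//; lra.
    rewrite !kE2//; apply: dH; first exact: U.
    rewrite (_ : _ - _ = 2 * (s - t)); last by lra.
    by rewrite normrM ger0_norm//; lra.
- by rewrite kE1 ?mulr0//; lra.
- rewrite kE2; last by lra.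
  by have -> : 2 * 1 - 1 = 1 :> R by lra.
- move=> _ [t /= + <-]; rewrite in_itv/= => /andP[t0 t1].
  have [th|/ltW th] := leP t (1 / 2).
    by rewrite kE1//; apply: fA; exists (2 * t) => //; exact: L.
  by rewrite kE2//; apply: gA; exists (2 * t - 1) => //; exact: U.
Qed.

Lemma geodesic_joined x y u : is_geodesic x y u ->
  (forall z, mdist x z <= mdist x y -> A z) -> path_joined A x y.
Proof.
set a := mdist x y => -[u0 ua ui] HA; have a0 : 0 <= a by exact: mdist_ge0.
have I (t : R) : `[0, 1]%classic t -> a * t \in `[0, a].
  rewrite /= !in_itv/= => /andP[t0 t1].
  by rewrite mulr_ge0//= ler_piMr.
exists (fun t => u (a * t)); split; rewrite ?mulr0 ?mulr1//.
  apply/within_mdistP => s e s01 e0; exists (e / (a + 1)).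
    by rewrite divr_gt0// ltr_wpDl.
  move=> t t01; rewrite ui ?I// -mulrBr normrM (ger0_norm a0).
  rewrite ltr_pdivlMr ?ltr_wpDl// => h; apply: le_lt_trans h.
  by rewrite mulrC ler_wpM2l// lerDl.
move=> _ [t t01 <-]; apply: HA; have /itvP E := I _ t01.
by rewrite -{1}u0 ui ?I ?in_itv/= ?lexx ?a0// sub0r normrN ger0_norm ?E.
Qed.

End paths.

Section end_equivalence.
Context {R : realType} {X : metricType R}.

Lemma to_halfline_lip (s t : R) :
  mdist (to_halfline s) (to_halfline t) <= `|s - t|.
Proof.
rewrite halfline_dist /hval/=.
have A1 := ler_norm (s - t); have := ler_norm (t - s); rewrite distrC => A2.
by rewrite ler_norml; have [s0|s0] := leP 0 s; have [t0|t0] := leP 0 t;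
  apply/andP; split; lra.
Qed.

Lemma end_equiv_refl (r : proper_ray X) : end_equiv r r.
Proof.
move=> B /(ray_proper r)/mbounded_halfline[M HM].
pose a := to_halfline (`|M| + 1).
have aE : hval a = `|M| + 1 by rewrite to_halflineK// addr_ge0.
have Mn s : hval a <= hval s -> ~ B (r s).
  by move=> as_ /HM; have := ler_norm M; lra.
exists a, (r a).
suff K : r @` [set s | hval a <= hval s] `<=` path_component (~` B) (r a).
  by split => //; exact: Mn.
move=> _ [s /= as_ <-].
have sa : 0 <= hval s - hval a by lra.
exists (fun t => r (to_halfline (hval a + t * (hval s - hval a)))); split.
- apply/within_mdistP => t e _ e0.
  have /continuous_mdistP/(_ (to_halfline (hval a + t * (hval s - hval a))) e e0)[d d0 dH] := @ray_continuous _ _ r.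
  exists (d / (hval s - hval a + 1)); first by rewrite divr_gt0// ltr_wpDl.
  move=> t' _; rewrite ltr_pdivlMr ?ltr_wpDl// => h; apply: dH.
  apply: le_lt_trans (to_halfline_lip _ _) _; apply: le_lt_trans h.
  rewrite opprD addrACA subrr add0r -mulrBl normrM (ger0_norm sa).
  by rewrite ler_wpM2l// lerDl.
- by rewrite mul0r addr0 hvalK.
- by rewrite mul1r addrCA subrr addr0 hvalK.
- move=> _ [t /= + <-]; rewrite in_itv/= => /andP[t0 t1]; apply: Mn.
  have ts : 0 <= t * (hval s - hval a) by rewrite mulr_ge0.
  by rewrite [leRHS]to_halflineK ?lerDl// addr_ge0// hval_ge0.
Qed.

Lemma end_equiv_sym (r r' : halfline R -> X) : end_equiv r r' -> end_equiv r' r.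
Proof. by move=> + B Bb => /(_ B Bb)[t [x [? ? ?]]]; exists t, x. Qed.

Lemma end_equiv_trans (r r' r'' : halfline R -> X) :
  end_equiv r r' -> end_equiv r' r'' -> end_equiv r r''.
Proof.
move=> H1 H2 B Bb; have [t [x [Bx xr xr']]] := H1 B Bb.
have [t' [x' [Bx' xr'2 xr'']]] := H2 B Bb.
pose m := to_halfline (Num.max (hval t) (hval t')).
have mE : hval m = Num.max (hval t) (hval t').
  by rewrite to_halflineK// le_max hval_ge0.
have tm : hval t <= hval m by rewrite mE le_max lexx.
have t'm : hval t' <= hval m by rewrite mE le_max lexx orbT.
exists m, x; split => // _ [s /= ms <-].
  by apply: xr; exists s => //=; exact: le_trans ms.
have xx' : path_joined (~` B) x x'.
  apply: (@path_joined_trans _ _ _ _ (r' m)); first by apply: xr'; exists m.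
  by apply: path_joined_sym; apply: xr'2; exists m.
apply: path_joined_trans xx' _; apply: xr''; exists s => //=.
exact: le_trans ms.
Qed.

End end_equivalence.

Section close_points.
Context {R : realType} {X : metricType R}.
Context (geoX : geodesic_space X).

Lemma close_joined (B : set X) (x0 z w : X) (rho S : R) :
  (forall b, B b -> mdist x0 b <= rho) ->
  rho + S < mdist x0 z -> mdist z w <= S -> path_joined (~` B) z w.
Proof.
move=> HB z0 zw; have [u ug] := geoX z w; apply: (geodesic_joined ug) => y zy.
move=> /HB yB; have := metric_triangle x0 y z; rewrite (metric_sym y).
by lra.
Qed.

Lemma chain_joined (B : set X) (x0 : X) (rho S : R) (p : nat -> X) :
  (forall b, B b -> mdist x0 b <= rho) ->
  (forall k, rho + S < mdist x0 (p k)) ->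
  (forall k, mdist (p k) (p k.+1) <= S) ->
  forall k, path_joined (~` B) (p 0%N) (p k).
Proof.
move=> HB far near; elim=> [|k IH].
  by apply: (close_joined HB (far 0%N)); rewrite mdistxx (le_trans _ (near 0%N))// mdist_ge0.
by apply: path_joined_trans IH _; exact: close_joined (far k) (near k).
Qed.

End close_points.

Section star_facts.
Context {R : realType} {X : metricType R}.
Context (u : X -> X -> R -> X).
Context (uP : forall x y, is_geodesic x y (u x y)).

Let nth_pt (n : nat) : halfline R := to_halfline n%:R.

Lemma floor_nat (n : nat) (x : R) : n%:R <= x -> x < n.+1%:R ->
  (Num.floor x)%:~R = n%:R :> R.
Proof.
move=> nx xn; rewrite (@floor_def _ x n%:Z)// intrD -!pmulrn nx/=.
by rewrite -natr1 in xn.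
Qed.

Lemma ceil_nat (n : nat) (x : R) : n%:R < x -> x <= n.+1%:R ->
  (Num.ceil x)%:~R = n.+1%:R :> R.
Proof.
move=> nx xn; rewrite (@ceil_def _ x n.+1%:Z)// intrB -!pmulrn xn andbT.
by rewrite -natr1 addrK.
Qed.

Lemma floor_halfline (h : halfline R) : exists n : nat,
  n%:R <= hval h /\ hval h < n.+1%:R.
Proof.
have := floor_itv (hval h); have : 0 <= Num.floor (hval h).
  by rewrite floor_ge0 hval_ge0.
case: (Num.floor (hval h)) => // n _ /andP[nh hn].
by exists n; split => //; rewrite intrD -pmulrn natr1 in hn.
Qed.

Lemma starE (r : halfline R -> X) (n : nat) (h : halfline R) :
  n%:R <= hval h -> hval h <= n.+1%:R ->
  star u r h = u (r (nth_pt n)) (r (nth_pt n.+1))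
    (mdist (r (nth_pt n)) (r (nth_pt n.+1)) * (hval h - n%:R)).
Proof.
have n1 k : (k%:R : R) < k.+1%:R by rewrite ltr_nat.
have u0 x y : u x y 0 = x by have [] := uP x y.
rewrite le_eqVlt => /predU1P[nh _|nh].
  rewrite /star -nh (@floor_nat n)// subrr !mulr0 !u0.
  by [].
rewrite le_eqVlt => /predU1P[hn|hn].
  rewrite /star hn (@floor_nat n.+1)// (@ceil_nat n)// subrr mulr0 u0.
  rewrite -natrB// subSnn mulr1.
  by have [_ ->] := uP (r (nth_pt n)) (r (nth_pt n.+1)).
by rewrite /star (@floor_nat n) ?(ltW nh)// (@ceil_nat n)// ltW.
Qed.

Context (r : halfline R -> X) (S : R).
Context (rS : forall s t, mdist s t < 2 -> mdist (r s) (r t) < S).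

Lemma nth_ptE n : hval (nth_pt n) = n%:R.
Proof. by rewrite to_halflineK. Qed.

Lemma nth_pt_step n : mdist (r (nth_pt n)) (r (nth_pt n.+1)) <= S.
Proof.
apply/ltW/rS; rewrite halfline_dist !nth_ptE -natr1 opprD addNKr.
by rewrite normrN normr1 ltr1n.
Qed.

Lemma star_seg n s t : n%:R <= hval s -> hval s <= n.+1%:R ->
  n%:R <= hval t -> hval t <= n.+1%:R ->
  mdist (star u r s) (star u r t) <= S * `|hval s - hval t|.
Proof.
move=> ns sn nt tn; rewrite (starE _ ns sn) (starE _ nt tn).
set a := mdist (r _) (r _); have a0 : 0 <= a by exact: mdist_ge0.
have I (h : halfline R) : n%:R <= hval h -> hval h <= n.+1%:R ->
    a * (hval h - n%:R) \in `[0, a].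
  rewrite -natr1 => nh hn; rewrite in_itv/=; apply/andP; split.
    by rewrite mulr_ge0//; lra.
  by rewrite ler_piMr//; lra.
have [_ _ ui] := uP (r (nth_pt n)) (r (nth_pt n.+1)).
rewrite ui; try exact: I.
rewrite -mulrBr opprB addrA subrK normrM (ger0_norm a0).
by rewrite ler_wpM2r// nth_pt_step.
Qed.

Lemma star_nth n : star u r (nth_pt n) = r (nth_pt n).
Proof.
have n1 : (n%:R : R) <= n.+1%:R by rewrite ler_nat.
rewrite (@starE r n) ?nth_ptE// subrr mulr0.
by have [] := uP (r (nth_pt n)) (r (nth_pt n.+1)).
Qed.

Lemma star_near n s : n%:R <= hval s -> hval s <= n.+1%:R ->
  mdist (r (nth_pt n)) (star u r s) <= S.
Proof.
move=> ns sn; have n1 : (n%:R : R) <= n.+1%:R by rewrite ler_nat.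
have := @star_seg n (nth_pt n) s; rewrite star_nth nth_ptE.
move=> /(_ (lexx _) n1 ns sn) /le_trans; apply; rewrite ler_piMr//.
  exact: le_trans (mdist_ge0 _ _) (nth_pt_step 0).
by rewrite distrC ger0_norm; move: sn; rewrite -natr1; lra.
Qed.

Lemma star_lip1 s t : hval s <= hval t -> hval t <= hval s + 1 ->
  mdist (star u r s) (star u r t) <= S * (hval t - hval s).
Proof.
move=> st ts; have [n [ns sn]] := floor_halfline s.
have tn2 : hval t <= n.+2%:R by move: sn; rewrite -!natr1; lra.
have [tn|/ltW nt] := leP (hval t) n.+1%:R.
  have := star_seg ns (ltW sn) (le_trans ns st) tn.
  by rewrite distrC ger0_norm// subr_ge0.
have n12 : (n.+1%:R : R) <= n.+2%:R by rewrite ler_nat.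
have n01 : (n%:R : R) <= n.+1%:R by rewrite ler_nat.
have := @star_seg n s (nth_pt n.+1); have := @star_seg n.+1 (nth_pt n.+1) t.
rewrite !nth_ptE => /(_ (lexx _) n12 nt tn2) A /(_ ns (ltW sn) n01 (lexx _)) B.
have := metric_triangle (star u r s) (star u r (nth_pt n.+1)) (star u r t).
move: A B; rewrite distrC (distrC (hval s)) !ger0_norm ?subr_ge0// ?(ltW sn)//.
by rewrite !mulrBr; lra.
Qed.

Lemma star_continuous : continuous (star u r).
Proof.
have S0 : 0 <= S by exact: le_trans (mdist_ge0 _ _) (nth_pt_step 0).
apply/continuous_mdistP => s e e0.
have d0 : 0 < Num.min 1 (e / (S + 1)).
  by rewrite lt_min ltr01 divr_gt0// ltr_wpDl.
exists (Num.min 1 (e / (S + 1))) => // t.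
rewrite halfline_dist lt_min => /andP[st1 st2].
suff : mdist (star u r s) (star u r t) <= S * `|hval s - hval t|.
  move=> /le_lt_trans; apply; rewrite ltr_pdivlMr ?ltr_wpDl// in st2.
  apply: le_lt_trans st2; rewrite mulrC ler_wpM2l// lerDl//.
have [h|/ltW h] := leP (hval s) (hval t).
  move: st1; rewrite distrC ger0_norm ?subr_ge0// => st1.
  by apply: star_lip1 => //; lra.
move: st1; rewrite ger0_norm ?subr_ge0// metric_sym => st1.
by apply: star_lip1 => //; lra.
Qed.

Lemma star_proper : metrically_proper r -> metrically_proper (star u r).
Proof.
move=> rp B /(mboundedP (r (nth_pt 0)))[M HM].
have /rp/mbounded_halfline[T HT] :
    mbounded [set x | mdist (r (nth_pt 0)) x <= M + S].
  by apply/(mboundedP (r (nth_pt 0))); exists (M + S).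
apply/mbounded_halfline; exists (T + 1) => t /= /HM tM.
have [n [nt tn]] := floor_halfline t.
have : hval (nth_pt n) <= T.
  apply: HT => /=; apply: le_trans (metric_triangle _ (star u r t) _) _.
  by rewrite lerD// metric_sym star_near// ltW.
by rewrite nth_ptE; move: tn; rewrite -natr1; lra.
Qed.

End star_facts.

Section cylinder_facts.
Context {R : realType} {X : metricType R} (q : X -> halfline R).

Lemma cylinder_dist (p p' : cylinder q) : mdist p p' =
  Num.max (mdist (\val p).1 (\val p').1)
          `|hval (\val p).2 - hval (\val p').2|.
Proof. by rewrite -halfline_dist. Qed.

Lemma cylinder_le (p : cylinder q) :
  hval (\val p).2 <= hval (q (\val p).1).
Proof. exact: set_mem (valP p). Qed.

Lemma cyl1 x t : (\val (cyl q x t)).1 = x.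
Proof. by []. Qed.

Lemma cyl2 x t : 0 <= t -> t <= hval (q x) -> hval (\val (cyl q x t)).2 = t.
Proof.
move=> t0 tq; rewrite [LHS]to_halflineK; first exact/min_idPl.
by rewrite le_min t0 hval_ge0.
Qed.

Lemma cylK (p : cylinder q) : cyl q (\val p).1 (hval (\val p).2) = p.
Proof.
apply/val_inj; have /= := cylinder_le p; case: (\val p) => x t /= /min_idPl ->.
by rewrite hvalK.
Qed.

Lemma cyl_dist x y s t : 0 <= s -> s <= hval (q x) ->
  0 <= t -> t <= hval (q y) ->
  mdist (cyl q x s) (cyl q y t) = Num.max (mdist x y) `|s - t|.
Proof. by move=> *; rewrite cylinder_dist !cyl2. Qed.

End cylinder_facts.

Section eta_well_defined.
Context {R : realType} {X : metricType R}.
Context (geoX : geodesic_space X).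
Context (u v : X -> X -> R -> X).
Context (uP : forall x y, is_geodesic x y (u x y)).
Context (vP : forall x y, is_geodesic x y (v x y)).

Lemma tail_joined (w : X -> X -> R -> X) (f : halfline R -> X)
    (B : set X) (x0 : X) (rho S : R) (n : nat) (h : halfline R) :
  (forall x y, is_geodesic x y (w x y)) ->
  (forall s t, mdist s t < 2 -> mdist (f s) (f t) < S) ->
  (forall b, B b -> mdist x0 b <= rho) ->
  (forall s, n%:R <= hval s -> rho + S < mdist x0 (f s)) ->
  n%:R <= hval h ->
  path_joined (~` B) (f (to_halfline n%:R)) (star w f h).
Proof.
move=> wP fS HB far nh; have [k [kh hk]] := floor_halfline h.
have nk : (n <= k)%N.
  by rewrite -ltnS -(ltr_nat R); exact: le_lt_trans hk.
pose p i := f (to_halfline (n + i)%:R).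
have farp i : rho + S < mdist x0 (p i).
  by apply: far; rewrite to_halflineK// ler_nat leq_addr.
apply: (@path_joined_trans _ _ _ _ (f (to_halfline k%:R))).
  have A := @chain_joined _ _ geoX B x0 rho S p HB farp.
  have := A _ (k - n)%N; rewrite /p addn0 subnKC//; apply => i.
  by rewrite addnS; exact: nth_pt_step.
apply: (close_joined geoX HB); last exact: (star_near wP fS kh (ltW hk)).
by apply: far; rewrite to_halflineK// ler_nat.
Qed.

Lemma min_step (a c : R) : `|Num.min a c - Num.min (a + 1) c| < 2.
Proof.
by rewrite ltr_norml; apply/andP; have [?|?] := leP a c;
  have [?|?] := leP (a + 1) c; split; lra.
Qed.

Lemma coarse_homotopic_end (f g : halfline R -> X) : coarse f -> coarse g ->
  coarse_homotopic f g -> end_equiv (star u f) (star v g).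
Proof.
move=> [fc fp] [gc gp] [q [[qc qp] [H [[Hc Hp] Hfg]]]] B.
pose x0 := f (to_halfline 0).
move=> /(mboundedP x0)[rho HB].
have [s1 s10 fS] := fc 2 (ltr0n _ 2); have [s2 s20 gS] := gc 2 (ltr0n _ 2).
have [s3 s30 HS] := Hc 2 (ltr0n _ 2).
pose S := s1 + s2 + s3.
have {}fS s t : mdist s t < 2 -> mdist (f s) (f t) < S.
  by move=> /fS; rewrite /S; lra.
have {}gS s t : mdist s t < 2 -> mdist (g s) (g t) < S.
  by move=> /gS; rewrite /S; lra.
have {}HS s t : mdist s t < 2 -> mdist (H s) (H t) < S.
  by move=> /HS; rewrite /S; lra.
have Kb : mbounded [set x | mdist x0 x <= rho + S].
  by apply/(mboundedP x0); exists (rho + S).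
have /mbounded_halfline[T1 HT1] := fp _ Kb.
have /mbounded_halfline[T2 HT2] := gp _ Kb.
have /(mboundedP (cyl q (to_halfline 0) 0))[T3 HT3] := Hp _ Kb.
pose T := `|T1| + `|T2| + `|T3| + 1.
have T0 : 0 <= T by rewrite !addr_ge0.
have [n [_ Tn]] := floor_halfline (to_halfline T).
rewrite to_halflineK// in Tn.
have N1 := ler_norm T1; have N2 := ler_norm T2; have N3 := ler_norm T3.
have P1 := normr_ge0 T1; have P2 := normr_ge0 T2; have P3 := normr_ge0 T3.
pose m := to_halfline (n.+1%:R : R).
have mE : hval m = n.+1%:R by rewrite to_halflineK.
have ffar s : n.+1%:R <= hval s -> rho + S < mdist x0 (f s).
  by move=> ns; rewrite ltNge; apply/negP => /HT1; rewrite /T in Tn *; lra.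
have gfar s : n.+1%:R <= hval s -> rho + S < mdist x0 (g s).
  by move=> ns; rewrite ltNge; apply/negP => /HT2; rewrite /T in Tn *; lra.
have Hfar t : rho + S < mdist x0 (H (cyl q m t)).
  rewrite ltNge; apply/negP => /HT3.
  rewrite cylinder_dist ge_max !cyl1 => /andP[+ _].
  rewrite halfline_dist to_halflineK// sub0r normrN ger0_norm ?hval_ge0//.
  by rewrite mE /T in Tn *; lra.
have S0 : 0 <= S by rewrite /S; lra.
have Hstep (a b : R) : 0 <= a -> a <= hval (q m) -> 0 <= b -> b <= hval (q m) ->
   `|a - b| < 2 -> mdist (H (cyl q m a)) (H (cyl q m b)) <= S.
  move=> a0 aq b0 bq ab; apply/ltW/HS.
  by rewrite cyl_dist// gt_max mdistxx ltr0n.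
have [j [jq qj]] := floor_halfline (q m).
pose p i := H (cyl q m (Num.min i%:R (hval (q m)))).
have p0 : p 0%N = f m.
  by rewrite /p (min_idPl (hval_ge0 _)); have [] := Hfg m.
have pj : p j.+1 = g m.
  by rewrite /p (min_idPr (ltW qj)); have [] := Hfg m.
have fgm : path_joined (~` B) (f m) (g m).
  rewrite -p0 -pj; apply: (chain_joined geoX HB (S := S)) => [k|k].
    exact: Hfar.
  apply: Hstep; rewrite ?le_min ?ge_min ?ler0n ?hval_ge0 ?lexx ?orbT//.
  by rewrite -natr1 min_step.
exists m, (f m); split.
- move=> /HB; have := ffar m; rewrite mE lexx => /(_ isT).
  by lra.
- move=> _ [h /= mh <-]; rewrite mE in mh.
  exact: (tail_joined uP fS HB ffar mh).
- move=> _ [h /= mh <-]; rewrite mE in mh.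
  apply: path_joined_trans fgm _.
  exact: (tail_joined vP gS HB gfar mh).
Qed.

End eta_well_defined.

Section coarse_homotopy_equivalence.
Context {R : realType} {X : metricType R}.

Lemma halfline_bound (q : halfline R -> halfline R) : controlled q ->
  forall M, exists K, forall x, hval x <= M -> hval (q x) <= K.
Proof.
move=> qc M; have M0 : 0 < `|M| + 1 by rewrite ltr_wpDl.
have [s s0 H] := qc _ M0; exists (hval (q (to_halfline 0)) + s) => x xM.
have : mdist x (to_halfline 0) < `|M| + 1.
  rewrite halfline_dist to_halflineK// subr0 ger0_norm ?hval_ge0//.
  by have := ler_norm M; lra.
by move=> /H; rewrite halfline_dist ltr_norml => /andP[]; lra.
Qed.

Lemma mbounded_cylinder (q : halfline R -> halfline R) (A : set (cylinder q)) :
  controlled q ->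
  mbounded A <-> exists M, forall p, A p -> hval (\val p).1 <= M.
Proof.
move=> qc; rewrite (mboundedP (cyl q (to_halfline 0) 0)); split=> -[M HM].
  exists M => p /HM; rewrite cylinder_dist ge_max cyl1 => /andP[+ _].
  by rewrite halfline_dist to_halflineK// sub0r normrN ger0_norm ?hval_ge0.
have [K HK] := halfline_bound qc M.
exists (Num.max M K) => p /HM pM.
rewrite cylinder_dist cyl1 cyl2 ?hval_ge0// sub0r normrN.
rewrite halfline_dist to_halflineK// sub0r normrN !ger0_norm ?hval_ge0//.
rewrite ge_max !le_max pM/=; apply/orP; right.
exact: le_trans (cylinder_le p) (HK _ pM).
Qed.

(* Coarseness of a map on a cylinder, in terms of coordinates. *)
Lemma cylinder_coarseP (q : halfline R -> halfline R) (H : cylinder q -> X) :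
  controlled q ->
  (forall r, 0 < r -> exists2 s, 0 < s & forall p p' : cylinder q,
     mdist (\val p).1 (\val p').1 < r ->
     hval (\val p).2 <= hval (\val p').2 ->
     hval (\val p').2 < hval (\val p).2 + r ->
     mdist (H p) (H p') < s) ->
  (forall B, mbounded B -> exists M, forall p, B (H p) -> hval (\val p).1 <= M) ->
  coarse H.
Proof.
move=> qc Hc Hp; split=> [r /Hc[s s0 HS]|B /Hp ?]; last first.
  exact/mbounded_cylinder.
exists s => // p p'; rewrite cylinder_dist gt_max => /andP[d].
rewrite ltr_norml => /andP[d1 d2].
have [h|/ltW h] := leP (hval (\val p).2) (hval (\val p').2).
  by apply: HS => //; lra.
by rewrite metric_sym; apply: HS; rewrite 1?metric_sym//; lra.
Qed.

Lemma halfline_id_coarse : coarse (@id (halfline R)).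
Proof. by split => // r r0; exists r. Qed.

Lemma coarse_homotopic_refl (f : halfline R -> X) :
  coarse f -> coarse_homotopic f f.
Proof.
move=> [fc fp]; exists id; split; first exact: halfline_id_coarse.
exists (fun p => f (\val p).1); split; last by move=> x; rewrite !cyl1.
apply: cylinder_coarseP; first by case: halfline_id_coarse.
  by move=> r /fc[s s0 fS]; exists s => // p p' + _ _; exact: fS.
by move=> B /fp/mbounded_halfline[M HM]; exists M => p /HM.
Qed.

Lemma coarse_homotopic_sym (f g : halfline R -> X) :
  coarse_homotopic f g -> coarse_homotopic g f.
Proof.
move=> [q [[qc qp] [H [[Hc Hp] Hfg]]]]; exists q; split=> //.
pose rv (p : cylinder q) :=
  hval (q (\val p).1) - hval (\val p).2.
have rv0 p : 0 <= rv p by rewrite subr_ge0 cylinder_le.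
have rvq p : rv p <= hval (q (\val p).1) by rewrite gerBl hval_ge0.
exists (fun p => H (cyl q (\val p).1 (rv p))); split; last first.
  move=> x; have [H0 H1] := Hfg x; rewrite /rv !cyl1 !cyl2 ?hval_ge0//.
  by rewrite subr0 subrr.
apply: cylinder_coarseP => // [r r0|B /Hp/(mbounded_cylinder _ qc)[M HM]].
  have [s s0 qS] := qc _ r0.
  have [t t0 HT] := Hc _ (addr_gt0 r0 s0).
  exists t => // p p' pp' h1 h2; apply: HT.
  rewrite cyl_dist// gt_max; apply/andP; split; first by lra.
  move/qS: pp'; rewrite halfline_dist !ltr_norml /rv => /andP[a b].
  by apply/andP; split; lra.
by exists M => p /HM; rewrite cyl1.
Qed.

Lemma coarse_homotopic_trans (f g h : halfline R -> X) :
  coarse_homotopic f g -> coarse_homotopic g h -> coarse_homotopic f h.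
Proof.
move=> [q [[qc qp] [H [[Hc Hp] Hfg]]]] [k [[kc kp] [G [[Gc Gp] Ggh]]]].
pose l x := to_halfline (hval (q x) + hval (k x)).
have lE x : hval (l x) = hval (q x) + hval (k x).
  by rewrite to_halflineK// addr_ge0// hval_ge0.
have lc : controlled l.
  move=> r r0; have [s s0 qS] := qc _ r0; have [t t0 kT] := kc _ r0.
  exists (s + t); first exact: addr_gt0.
  move=> x y xy; have := qS _ _ xy; have := kT _ _ xy.
  rewrite !halfline_dist !lE !ltr_norml => /andP[a b] /andP[c d].
  by apply/andP; split; lra.
exists l; split.
  split=> // B /mbounded_halfline[M HM].
  have : mbounded [set t : halfline R | hval t <= M].
    by apply/mbounded_halfline; exists M.
  move=> /qp/mbounded_halfline[N HN]; apply/mbounded_halfline; exists N => x /HM.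
  by rewrite lE => xM; apply: HN => /=; have := hval_ge0 (k x); lra.
pose x_ (p : cylinder l) := (\val p).1; pose t_ (p : cylinder l) := hval (\val p).2.
have t0 p : 0 <= t_ p by exact: hval_ge0.
have tl p : t_ p <= hval (q (x_ p)) + hval (k (x_ p)).
  by rewrite -lE; exact: cylinder_le.
pose F p := if t_ p <= hval (q (x_ p)) then H (cyl q (x_ p) (t_ p))
            else G (cyl k (x_ p) (t_ p - hval (q (x_ p)))).
have FG p : hval (q (x_ p)) <= t_ p ->
    F p = G (cyl k (x_ p) (t_ p - hval (q (x_ p)))).
  rewrite /F le_eqVlt => /predU1P[e|e]; last by rewrite leNgt e.
  rewrite -e lexx subrr; have [_ ->] := Hfg (x_ p).
  by have [-> _] := Ggh (x_ p).
exists F; split; last first.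
  move=> x; have q0 := hval_ge0 (q x); have k0 := hval_ge0 (k x); split.
    rewrite /F /t_ /x_ !cyl1 cyl2 ?hval_ge0//.
    by have [] := Hfg x.
  rewrite FG /t_ /x_ cyl1 cyl2 ?hval_ge0// lE ?lerDl//.
  by rewrite addrAC subrr add0r; have [] := Ggh x.
apply: cylinder_coarseP => // [r r0|B Bb].
  have [s s0 qS] := qc _ r0.
  have rs := addr_gt0 r0 s0.
  have [a a0 HA] := Hc _ rs; have [b b0 GB] := Gc _ rs.
  exists (a + b); first exact: addr_gt0.
  move=> p p'; rewrite -/(x_ p) -/(x_ p') -/(t_ p) -/(t_ p') => xx tt tr.
  have := qS _ _ xx; rewrite halfline_dist ltr_norml => /andP[c d].
  have := tl p; have := tl p'; have := t0 p; have := t0 p' => u1 u2 u3 u4.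
  have Q1 := hval_ge0 (q (x_ p)); have Q2 := hval_ge0 (q (x_ p')).
  have K1 := hval_ge0 (k (x_ p)); have K2 := hval_ge0 (k (x_ p')).
  have xrs : mdist (x_ p) (x_ p') < r + s by lra.
  have HH u v : 0 <= u -> u <= hval (q (x_ p)) -> 0 <= v ->
      v <= hval (q (x_ p')) -> `|u - v| < r + s ->
      mdist (H (cyl q (x_ p) u)) (H (cyl q (x_ p') v)) < a.
    by move=> *; apply: HA; rewrite cyl_dist// gt_max xrs.
  have GG u v : 0 <= u -> u <= hval (k (x_ p)) -> 0 <= v ->
      v <= hval (k (x_ p')) -> `|u - v| < r + s ->
      mdist (G (cyl k (x_ p) u)) (G (cyl k (x_ p') v)) < b.
    by move=> *; apply: GB; rewrite cyl_dist// gt_max xrs.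
  have HGt x : H (cyl q x (hval (q x))) = G (cyl k x 0).
    by have [_ ->] := Hfg x; have [->] := Ggh x.
  have [tq|/ltW tq] := leP (t_ p) (hval (q (x_ p)));
    have [tq'|/ltW tq'] := leP (t_ p') (hval (q (x_ p'))).
  - rewrite /F tq tq'; apply: (@lt_trans _ _ a); last by lra.
    by apply: HH => //; rewrite ltr_norml; apply/andP; split; lra.
  - rewrite (FG p')// /F tq.
    apply: le_lt_trans (metric_triangle _ (H (cyl q (x_ p') (hval (q (x_ p'))))) _) _.
    rewrite {2}HGt; apply: ltrD.
      by apply: HH => //; rewrite ltr_norml; apply/andP; split; lra.
    apply: GB; rewrite cyl_dist//; try lra.
    by rewrite gt_max mdistxx rs/= ltr_norml; apply/andP; split; lra.
  - rewrite (FG p)// /F tq'.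
    apply: le_lt_trans (metric_triangle _ (G (cyl k (x_ p') 0)) _) _.
    rewrite -{2}HGt addrC; apply: ltrD.
      apply: HA; rewrite cyl_dist//; try lra.
      by rewrite gt_max mdistxx rs/= ltr_norml; apply/andP; split; lra.
    by apply: GG; rewrite ?ltr_norml//; try lra; apply/andP; split; lra.
  - rewrite (FG p)// (FG p')//; apply: (@lt_trans _ _ b); last by lra.
    by apply: GG; rewrite ?ltr_norml//; try lra; apply/andP; split; lra.
have /(mbounded_cylinder _ qc)[M HM] := Hp _ Bb.
have /(mbounded_cylinder _ kc)[N HN] := Gp _ Bb.
exists (Num.max M N) => p; rewrite /F le_max; case: ifPn => _.
  by move=> /HM; rewrite cyl1 => ->.
by move=> /HN; rewrite cyl1 => ->; rewrite orbT.
Qed.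

End coarse_homotopy_equivalence.

Section eta.
Context {R : realType}.
Local Open Scope quotient_scope.

Definition coarse_homotopicb (X : metricType R)
    (a b : coarse_map (halfline R) X) : bool := `[< coarse_homotopic a b >].

Lemma coarse_homotopicb_equiv (X : metricType R) :
  equiv_class_of (@coarse_homotopicb X).
Proof.
split.
- by move=> a; apply/asboolP/coarse_homotopic_refl/coarse_mapP.
- by move=> a b; apply/asboolP/asboolP; exact: coarse_homotopic_sym.
- by move=> b a c /asboolP ab /asboolP bc; apply/asboolP;
    exact: coarse_homotopic_trans ab bc.
Qed.

Canonical coarse_homotopy_rel (X : metricType R) :=
  EquivRelPack (@coarse_homotopicb_equiv X).

Definition pi0_crs (X : metricType R) : Type :=
  {eq_quot (@coarse_homotopy_rel X)}.

Definition pi0_class (X : metricType R) (a : coarse_map (halfline R) X) :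
  pi0_crs X := \pi a.

Definition end_equivb (X : metricType R) (r r' : proper_ray X) : bool :=
  `[< end_equiv r r' >].

Lemma end_equivb_equiv (X : metricType R) : equiv_class_of (@end_equivb X).
Proof.
split.
- by move=> r; apply/asboolP/end_equiv_refl.
- by move=> r r'; apply/asboolP/asboolP; exact: end_equiv_sym.
- by move=> r' r r'' /asboolP ? /asboolP ?; apply/asboolP;
    exact: end_equiv_trans (r' : halfline R -> X) _ _ _.
Qed.

Canonical end_rel (X : metricType R) := EquivRelPack (@end_equivb_equiv X).

Definition Ends (X : metricType R) : Type := {eq_quot (@end_rel X)}.

Definition end_of (X : metricType R) (r : proper_ray X) : Ends X := \pi r.

Lemma pi0_classP (X : metricType R) (a b : coarse_map (halfline R) X) :
  pi0_class a = pi0_class b <-> coarse_homotopic a b.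
Proof.
split=> [/eqP|ab]; first by rewrite eqmodE => /asboolP.
by apply/eqP; rewrite eqmodE; apply/asboolP.
Qed.

Lemma end_ofP (X : metricType R) (r r' : proper_ray X) :
  end_of r = end_of r' <-> end_equiv r r'.
Proof.
split=> [/eqP|rr']; first by rewrite eqmodE => /asboolP.
by apply/eqP; rewrite eqmodE; apply/asboolP.
Qed.

Lemma geodP (X : pgeo R) (x y : X) : is_geodesic x y (geod x y).
Proof. exact: svalP (cid (pgeo_geodesic x y)). Qed.

Lemma geod_star_continuous (X : pgeo R) (a : coarse_map (halfline R) X) :
  continuous (star (@geod R X) a).
Proof.
have [/(_ 2 (ltr0n _ 2))[S _ aS] _] := coarse_mapP a.
exact: (star_continuous (@geodP X) aS).
Qed.

Lemma geod_star_proper (X : pgeo R) (a : coarse_map (halfline R) X) :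
  metrically_proper (star (@geod R X) a).
Proof.
have [/(_ 2 (ltr0n _ 2))[S _ aS] ap] := coarse_mapP a.
exact: (star_proper (@geodP X) aS ap).
Qed.

Definition star_ray (X : pgeo R) (a : coarse_map (halfline R) X) :
  proper_ray X :=
  ProperRay (@geod_star_continuous X a) (@geod_star_proper X a).

(* [eta] is computed on a chosen representative; [eta_class] shows that the
   result does not depend on it. *)
Definition eta (X : pgeo R) (c : pi0_crs X) : Ends X :=
  end_of (star_ray (repr c)).

Lemma eta_class (X : pgeo R) (a : coarse_map (halfline R) X) :
  eta (pi0_class a) = end_of (star_ray a).
Proof.
apply/end_ofP; apply: (coarse_homotopic_end (@pgeo_geodesic R X)).
- exact: geodP.
- exact: geodP.
- exact: coarse_mapP.
- exact: coarse_mapP.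
- by apply/pi0_classP; rewrite /pi0_class reprK.
Qed.

Lemma end_star_choice (X : pgeo R) (u : X -> X -> R -> X)
    (a : coarse_map (halfline R) X) :
  (forall x y, is_geodesic x y (u x y)) ->
  end_equiv (star_ray a) (star u a).
Proof.
move=> uP; apply: (coarse_homotopic_end (@pgeo_geodesic R X)) => //.
- exact: geodP.
- exact: coarse_mapP.
- exact: coarse_mapP.
- exact/coarse_homotopic_refl/coarse_mapP.
Qed.

End eta.

(* Main.v *)
(* Glue two half-lines along the points n^2: the result is a chain of circles
   whose lengths tend to infinity. The two copies of the half-line meet
   arbitrarily far out, so they define the same end. Suppose that H is a coarse
   homotopy between them, and let s bound its steps. Since the circles grow, all
   circles far out are long compared to s, so the signed number of times an
   s-path crosses a point mu on the upper half of such a circle is invariant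
   under homotopy in s-steps. The loop bounding the domain of H up to a large
   time N crosses mu exactly once: along the upper half-line, since H(0, -) stays
   before mu, H(N, -) beyond it, and the lower half-line avoids it. This
   contradicts invariance. *)

From HB Require Import structures.
Require Import Defs.
From mathcomp Require Import all_boot all_order all_algebra.
From mathcomp Require Import lra.
From mathcomp Require Import all_classical all_reals topology metric_structure.
From mathcomp Require Import normedtype.

Set Implicit Arguments.
Unset Strict Implicit.
Unset Printing Implicit Defensive.

Import Order.TTheory GRing.Theory Num.Theory.
Import numFieldTopology.Exports.
Import metricType_numDomainType.

Local Open Scope classical_set_scope.
Local Open Scope ring_scope.

(** * Shortest detours through pinch points *)

Section crossing.
Context {R : realType}.

Definition pinch : set R := [set x | exists n : nat, x = n%:R ^+ 2].

Lemma pinch0 : pinch 0.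
Proof. by exists 0%N; rewrite expr0n. Qed.

Lemma natr_le_sqr (n : nat) : (n%:R : R) <= n%:R ^+ 2.
Proof. by rewrite -natrX ler_nat; case: n => // n; rewrite expnS leq_pmulr. Qed.

(* Far pinch points are worse than 0, so the minimum is over a finite set. *)
Lemma nearest_pinch (x y : R) : exists a, pinch a /\
  forall b, pinch b -> `|x - a| + `|a - y| <= `|x - b| + `|b - y|.
Proof.
pose F (n : nat) : R := `|x - n%:R ^+ 2| + `|n%:R ^+ 2 - y|.
pose N := (Num.bound (`|x| + `|y|)).+1.
have [i _ iP] := @arg_minP _ R 'I_N ord0 predT F isT.
exists (i%:R ^+ 2); split; first by exists i.
move=> _ [n ->]; have [nN|Nn] := ltnP n N; first exact: (iP (Ordinal nN)).
apply: le_trans (iP ord0 isT) _; rewrite /F /= expr0n /= subr0 sub0r normrN.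
have : `|x| + `|y| < n%:R.
  apply: lt_le_trans (archi_boundP _) _; first by rewrite addr_ge0.
  by rewrite ler_nat ltnW.
have := natr_le_sqr n; have := ler_norm (n%:R ^+ 2 - y).
have := ler_norm (n%:R ^+ 2 - x); rewrite distrC.
by have := ler_norm x; have := ler_norm y; lra.
Qed.

(** This will be the distance from [x] on one half-line to [y] on the other: half-lines can only be
    changed at a pinch point. *)
Definition cross (x y : R) : R :=
  let a := sval (cid (nearest_pinch x y)) in `|x - a| + `|a - y|.

Lemma cross_le x y a : pinch a -> cross x y <= `|x - a| + `|a - y|.
Proof. by rewrite /cross; case: cid => /= b [_ +]; apply. Qed.

Lemma crossE x y : exists2 a, pinch a & cross x y = `|x - a| + `|a - y|.
Proof. by rewrite /cross; case: cid => /= b [? _]; exists b. Qed.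

Lemma crossC x y : cross x y = cross y x.
Proof.
apply/eqP; rewrite eq_le; apply/andP; split.
  have [a aP ->] := crossE y x; rewrite addrC distrC (distrC y).
  by rewrite cross_le.
have [a aP ->] := crossE x y; rewrite addrC distrC (distrC x).
by rewrite cross_le.
Qed.

Lemma dist_le_cross x y : `|x - y| <= cross x y.
Proof. by have [a _ ->] := crossE x y; exact: ler_distD. Qed.

Lemma cross_pinch x y : pinch x -> cross x y = `|x - y|.
Proof.
move=> xP; apply/eqP; rewrite eq_le dist_le_cross andbT.
by have := cross_le x y xP; rewrite subrr normr0 add0r.
Qed.

(** The pinch point that is optimal for [y] and [z] is a candidate for [x] and [z]. *)
Lemma cross_triangle x y z : cross x z <= `|x - y| + cross y z.
Proof.
have [a aP ->] := crossE y z; apply: le_trans (cross_le x z aP) _.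
by rewrite addrA lerD2r; exact: ler_distD.
Qed.

(** Consecutive squares are [2 * n + 1] apart, so [n ^ 2 + n] keeps distance at least [n] from all
    of them. *)
Lemma far_from_pinch (s M : R) : exists2 mu, M <= mu &
  forall a, pinch a -> s <= `|a - mu|.
Proof.
pose n := Num.bound (`|s| + `|M|).
have nP : `|s| + `|M| < n%:R by apply: archi_boundP; rewrite addr_ge0.
have := ler_norm s; have := ler_norm M.
have := normr_ge0 s; have := normr_ge0 M; have := natr_le_sqr n.
move=> nn M0 s0 M1 s1.
exists (n%:R ^+ 2 + n%:R); first by lra.
move=> _ [k ->]; have [kn|nk] := leqP k n.
  have ? : (k%:R : R) ^+ 2 <= n%:R ^+ 2 by rewrite -!natrX ler_nat leq_sqr.
  by rewrite ler0_norm; lra.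
have : (n.+1%:R : R) ^+ 2 <= k%:R ^+ 2 by rewrite -!natrX ler_nat leq_sqr.
by rewrite -natr1 sqrrD1 => ?; rewrite ger0_norm; lra.
Qed.

End crossing.

(* The two copies of a pinch point are identified by keeping only the upper one. *)
Record necklace (R : realType) := Necklace {
  pos : R;
  upper : bool;
  pos_ge0 : 0 <= pos;
  pinch_upper : pinch pos -> upper }.

HB.instance Definition _ (R : realType) := gen_eqMixin (necklace R).
HB.instance Definition _ (R : realType) := gen_choiceMixin (necklace R).

(** * The metric of the necklace *)

Section necklace_metric.
Context {R : realType}.
Implicit Types p q r : necklace R.

Lemma necklace_inj p q : pos p = pos q -> upper p = upper q -> p = q.
Proof.
case: p q => [x b x0 xb] [y c y0 yc] /= xy bc; subst y c.
by congr Necklace; exact: Prop_irrelevance.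
Qed.

Definition necklace_dist p q : R :=
  if upper p == upper q then `|pos p - pos q| else cross (pos p) (pos q).

Let dist_xx p : necklace_dist p p = 0.
Proof. by rewrite /necklace_dist eqxx subrr normr0. Qed.

Let dist_sym p q : necklace_dist p q = necklace_dist q p.
Proof. by rewrite /necklace_dist eq_sym distrC crossC. Qed.

Let dist_positivity p q : necklace_dist p q = 0 -> p = q.
Proof.
rewrite /necklace_dist; case: eqP => [pq /normr0_eq0/subr0_eq xy|_].
  exact: necklace_inj.
have [a aP ->] := crossE (pos p) (pos q).
move=> /eqP; rewrite paddr_eq0// !normr_eq0 !subr_eq0 => /andP[/eqP pa /eqP aq].
apply: necklace_inj; first by rewrite pa aq.
by rewrite !pinch_upper// -?aq ?pa.
Qed.

(** Changing half-lines twice is no shorter than going straight, by [dist_le_cross]; a single change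
    is [cross_triangle], read backwards if it occurs on the first leg. *)
Let dist_triangle q p r :
  necklace_dist p r <= necklace_dist p q + necklace_dist q r.
Proof.
rewrite /necklace_dist; have D := ler_distD (pos q) (pos p) (pos r).
have C1 := dist_le_cross (pos p) (pos q).
have C2 := dist_le_cross (pos q) (pos r).
case: (upper p) (upper q) (upper r) => -[] [] //=; try lra;
  try exact: cross_triangle.
- by rewrite addrC crossC (crossC (pos p)) (distrC (pos q)) cross_triangle.
- by rewrite addrC crossC (crossC (pos p)) (distrC (pos q)) cross_triangle.
Qed.

HB.instance Definition _ := @isMetric.Build R (necklace R) necklace_dist
  dist_xx dist_positivity dist_sym dist_triangle.

Lemma necklace_mdistE p q : mdist p q = necklace_dist p q.
Proof. by []. Qed.

Lemma pos_dist p q : `|pos p - pos q| <= mdist p q.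
Proof.
by rewrite necklace_mdistE /necklace_dist; case: ifP => // _; exact: dist_le_cross.
Qed.

Lemma mk_ge0 (x : R) : 0 <= Num.max 0 x.
Proof. by rewrite le_max lexx. Qed.

Lemma mk_pinch (x : R) (b : bool) :
  pinch (Num.max 0 x) -> b || `[< pinch (Num.max 0 x) >].
Proof. by move=> ?; apply/orP; right; apply/asboolP. Qed.

(** Total in [b] and [x]: negative [x] is truncated to 0, and the flag is raised at pinch points, so
    [mk false] runs through the common points too. *)
Definition mk (b : bool) (x : R) : necklace R :=
  Necklace (mk_ge0 x) (@mk_pinch x b).

Lemma pos_mk b x : 0 <= x -> pos (mk b x) = x.
Proof. by move=> x0; exact/max_idPr. Qed.

Lemma mkK p : mk (upper p) (pos p) = p.
Proof.
have E : Num.max 0 (pos p) = pos p by apply/max_idPr/pos_ge0.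
apply: necklace_inj; rewrite /= E//.
by apply/orb_idr => /asboolP/pinch_upper.
Qed.

(** A flag raised by [mk] does no harm, because [cross] is the plain distance at a pinch point. *)
Lemma mk_dist b c x y : 0 <= x -> 0 <= y ->
  mdist (mk b x) (mk c y) = if b == c then `|x - y| else cross x y.
Proof.
move=> /max_idPr x0 /max_idPr y0.
rewrite necklace_mdistE /necklace_dist /= x0 y0.
have C (a d : R) : pinch d -> cross a d = `|a - d|.
  by move=> ?; rewrite crossC cross_pinch// distrC.
case: (asboolP (pinch x)) => xP; case: (asboolP (pinch y)) => yP; case: b c => -[] //=;
  by rewrite ?(cross_pinch _ xP) ?(C _ _ yP).
Qed.

Lemma mk_pinch_eq b c a : pinch a -> mk b a = mk c a.
Proof.
move=> aP; have [n E] := aP; have a0 : 0 <= a by rewrite E sqr_ge0.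
by apply: mdist_positivity; rewrite mk_dist// cross_pinch// subrr normr0 if_same.
Qed.

Lemma dist_origin p : mdist (mk true 0) p = pos p.
Proof.
rewrite -{1}(mkK p) mk_dist ?pos_ge0// (cross_pinch _ pinch0) if_same.
by rewrite sub0r normrN ger0_norm ?pos_ge0.
Qed.

Lemma mbounded_necklace (B : set (necklace R)) :
  mbounded B <-> exists M, forall p, B p -> pos p <= M.
Proof.
by rewrite (mboundedP (mk true 0)); split=> -[M HM]; exists M => p /HM;
  rewrite dist_origin.
Qed.

End necklace_metric.

(** * Geodesics and properness of the necklace *)

Lemma geodesic_cat (R : realType) (X : metricType R) (x y z : X) (u v : R -> X) :
  is_geodesic x z u -> is_geodesic z y v ->
  mdist x z + mdist z y = mdist x y -> exists w, is_geodesic x y w.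
Proof.
set a := mdist x z; set b := mdist z y.
move=> [u0 + +] [v0 + +] xzy; rewrite -/a -/b => ua ui vb vi.
have a0 : 0 <= a by exact: mdist_ge0.
have b0 : 0 <= b by exact: mdist_ge0.
pose w t := if t <= a then u t else v (t - a).
have wv t : a <= t -> w t = v (t - a).
  rewrite /w le_eqVlt => /predU1P[<-|]; last by rewrite ltNge => /negPf ->.
  by rewrite lexx subrr ua v0.
have wi (s t : R) : 0 <= s -> s <= t -> t <= a + b -> mdist (w s) (w t) = t - s.
  move=> s0 st tab; have [ta|/ltW at_] := leP t a.
    rewrite /w ta (le_trans st ta) ui ?in_itv/=; last 2 first.
    - by rewrite s0 (le_trans st ta).
    - by rewrite (le_trans s0 st).
    by rewrite distrC ger0_norm// subr_ge0.
  have [sa|/ltW as_] := leP s a; last first.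
    rewrite !wv// vi ?in_itv/=; try (apply/andP; split; lra).
    by rewrite distrC ger0_norm; lra.
  rewrite (wv t)// /w sa.
  have us : mdist (u s) z = a - s.
    by rewrite -ua ui ?in_itv/= ?s0 ?a0 ?lexx// distrC ger0_norm// subr_ge0.
  have vt : mdist z (v (t - a)) = t - a.
    rewrite -v0 vi ?in_itv/= ?lexx ?b0//; last by apply/andP; split; lra.
    by rewrite sub0r normrN ger0_norm// subr_ge0.
  have xu : mdist x (u s) = s.
    by rewrite -{1}u0 ui ?in_itv/= ?lexx ?s0 ?a0// sub0r normrN ger0_norm.
  have vy : mdist (v (t - a)) y = a + b - t.
    rewrite -{1}vb vi ?in_itv/= ?lexx ?b0//; last by apply/andP; split; lra.
    by rewrite distrC ger0_norm; lra.
  (* The way through [z] gives the upper bound; for the lower one, a shortcut would bring [x] and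
     [y] closer than [a + b]. *)
  have := metric_triangle (u s) z (v (t - a)).
  have := metric_triangle x (u s) y; have := metric_triangle (u s) (v (t - a)) y.
  by move=> ? ? ?; apply/eqP; rewrite eq_le; apply/andP; split; lra.
exists w; split.
- by rewrite /w a0 u0.
- by rewrite -xzy wv ?lerDl// addrAC subrr add0r vb.
- move=> s t; rewrite -xzy !in_itv/= => /andP[s0 sL] /andP[t0 tL].
  have [st|/ltW ts] := leP s t.
    by rewrite wi// distrC ger0_norm// subr_ge0.
  by rewrite metric_sym wi// ger0_norm// subr_ge0.
Qed.

Section necklace_proper_geodesic.
Context {R : realType}.

Lemma sheet_geodesic (b : bool) (x y : R) : 0 <= x -> 0 <= y ->
  exists u, is_geodesic (mk b x) (mk b y) u.
Proof.
move=> x0 y0; rewrite /is_geodesic mk_dist// eqxx.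
exists (fun t => mk b (if x <= y then x + t else x - t)); have [xy|yx] := leP x y.
  rewrite distrC ger0_norm ?subr_ge0//; split; rewrite ?addr0 ?subrKC//.
  move=> s t; rewrite !in_itv/= => /andP[? ?] /andP[? ?].
  by rewrite mk_dist ?eqxx ?addr_ge0//; congr `| _ |; lra.
rewrite ger0_norm ?subr_ge0 ?(ltW yx)//; split; rewrite ?subr0 ?subKr//.
move=> s t; rewrite !in_itv/= => /andP[? ?] /andP[? ?].
rewrite mk_dist ?eqxx; try lra.
by rewrite distrC; congr `| _ |; lra.
Qed.

(** Points on different half-lines are joined through a pinch point at which the minimum [cross] is
    attained. *)
Lemma necklace_geodesic : geodesic_space (necklace R).
Proof.
move=> p q; rewrite -(mkK p) -(mkK q).
have p0 := pos_ge0 p; have q0 := pos_ge0 q.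
have [<-|pq] := eqVneq (upper p) (upper q); first exact: sheet_geodesic.
have [a aP E] := crossE (pos p) (pos q).
have a0 : 0 <= a by case: aP => n ->; exact: sqr_ge0.
have [u uP] := sheet_geodesic (upper p) p0 a0.
have [v vP] := sheet_geodesic (upper q) a0 q0.
rewrite (mk_pinch_eq _ (upper p) aP) in vP.
apply: (geodesic_cat uP vP).
by rewrite !mk_dist// eqxx (negPf pq) cross_pinch// if_same E.
Qed.

Lemma mk_continuous (b : bool) : continuous (mk b : R^o -> necklace R).
Proof.
apply/continuous_mdistP => x e e0; exists e => // y.
apply: le_lt_trans; rewrite necklace_mdistE.
have E (z : R) : mk b z = mk b (Num.max 0 z).
  by apply: necklace_inj; rewrite /= maxA maxxx.
rewrite (E x) (E y) -necklace_mdistE mk_dist ?le_max ?lexx// eqxx.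
rewrite /mdist /= distrC.
by have := to_halfline_lip y x; rewrite halfline_dist.
Qed.

Lemma necklace_compact (M : R) : compact [set p : necklace R | pos p <= M].
Proof.
have K b : compact [set mk b x | x in `[0, M]%classic].
  apply: (@continuous_compact R^o); last exact: segment_compact.
  by apply: continuous_subspaceT => x; exact: mk_continuous.
have -> : [set p : necklace R | pos p <= M] =
    [set mk true x | x in `[0, M]%classic] `|`
    [set mk false x | x in `[0, M]%classic].
  apply/seteqP; split => [p /= pM|p].
    have I : `[0, M]%classic (pos p) by rewrite /= in_itv/= pos_ge0.
    by rewrite -(mkK p); case: (upper p); [left|right]; exists (pos p).
  by case=> -[x /= + <-]; rewrite in_itv/= => /andP[x0 xM];
    rewrite /= ge_max xM (le_trans x0 xM).
exact: compactU.
Qed.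

Lemma necklace_proper : proper_space (necklace R).
Proof.
move=> A; split => [[Ac /mbounded_necklace[M HM]]|Ak].
  by apply: (subclosed_compact Ac (@necklace_compact M)) => p /HM.
split; first by apply: compact_closed => //; exact: metric_hausdorff.
apply/mbounded_necklace.
have pc : continuous (@pos R : necklace R -> R^o).
  apply/continuous_mdistP => p e e0; exists e => // q.
  by apply: le_lt_trans; rewrite /mdist/= distrC; exact: pos_dist.
have : compact (@pos R @` A : set R^o).
  by apply: continuous_compact => //; apply: continuous_subspaceT => x; exact: pc.
move=> /compact_bounded[M [_ /(_ (M + 1))]].
rewrite ltrDl ltr01 => /(_ isT) H; exists (M + 1) => p Ap.
by apply: le_trans (ler_norm _) (H _ _); exists p.
Qed.

Definition necklace_pgeo : pgeo R := PGeo necklace_proper necklace_geodesic.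

(** * The two half-lines and their common end *)

Definition sheet (b : bool) (t : halfline R) : necklace R := mk b (hval t).

Lemma sheet_isometry b s t : mdist (sheet b s) (sheet b t) = mdist s t.
Proof. by rewrite mk_dist ?hval_ge0// eqxx halfline_dist. Qed.

Lemma sheet_coarse b : coarse (sheet b).
Proof.
split => [r r0|B [M HM]]; first by exists r => // s t; rewrite sheet_isometry.
by exists M => s t Bs Bt; rewrite -(sheet_isometry b); exact: HM.
Qed.

Definition sheet_map b : coarse_map (halfline R) necklace_pgeo :=
  CoarseMap (sheet_coarse b).

Lemma sheets_end_equiv :
  end_equiv (star_ray (sheet_map true)) (star_ray (sheet_map false)).
Proof.
move=> B /mbounded_necklace[rho HB].
(* A square [n] is both an integer time and a pinch point, from which both tails start. The margin 2
   is the step bound that [tail_joined] asks of the isometric sheets. *)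
pose k := Num.bound `|rho + 2|; pose n := (k ^ 2)%N.
have nE : (n%:R : R) = k%:R ^+ 2 by rewrite natrX.
have nrho : rho + 2 < n%:R.
  apply: le_lt_trans (ler_norm _) (lt_le_trans (archi_boundP _) _) => //.
  by rewrite nE natr_le_sqr.
have nP : pinch (n%:R : R) by rewrite nE; eexists.
have tail b h : n%:R <= hval h ->
    path_joined (~` B) (mk true (n%:R : R)) (star_ray (sheet_map b) h).
  move=> nh; rewrite (mk_pinch_eq _ b nP).
  have := @tail_joined R (necklace R) necklace_geodesic (@geod R necklace_pgeo)
    (sheet b) B (mk true 0) rho 2 n h.
  rewrite /sheet to_halflineK//; apply => //.
  - exact: (@geodP R necklace_pgeo).
  - by move=> s t; rewrite sheet_isometry.
  - by move=> p /HB; rewrite dist_origin.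
  - by move=> s ns; rewrite dist_origin pos_mk ?hval_ge0//; lra.
exists (to_halfline n%:R), (mk true n%:R); split.
- by move=> /HB; rewrite pos_mk//; lra.
- by move=> _ [h /= + <-]; rewrite to_halflineK//; exact: tail.
- by move=> _ [h /= + <-]; rewrite to_halflineK//; exact: tail.
Qed.

End necklace_proper_geodesic.

(** * Discrete homotopies and signed crossings *)

(** A discrete Stokes formula: the path is pushed across the rectangle strip by strip, and across
    each strip square by square. *)
Lemma grid_boundary (V : zmodType) (X : Type) (c : X -> X -> V)
    (P : nat -> nat -> X) (N K : nat) :
  (forall i k, c (P i k) (P i k.+1) + c (P i k.+1) (P i.+1 k.+1) =
               c (P i k) (P i.+1 k) + c (P i.+1 k) (P i.+1 k.+1)) ->
  \sum_(0 <= k < K) c (P 0%N k) (P 0%N k.+1) +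
    \sum_(0 <= i < N) c (P i K) (P i.+1 K) =
  \sum_(0 <= i < N) c (P i 0%N) (P i.+1 0%N) +
    \sum_(0 <= k < K) c (P N k) (P N k.+1).
Proof.
move=> square.
have strip i : \sum_(0 <= k < K) c (P i k) (P i k.+1) + c (P i K) (P i.+1 K) =
    c (P i 0%N) (P i.+1 0%N) + \sum_(0 <= k < K) c (P i.+1 k) (P i.+1 k.+1).
  elim: K => [|K IH]; first by rewrite !(big_geq (leqnn 0)) addr0 add0r.
  by rewrite !big_nat_recr//= -addrA square addrA IH -addrA.
elim: N => [|N IH]; first by rewrite !(big_geq (leqnn 0)) addr0 add0r.
by rewrite !big_nat_recr//= addrA IH -addrA strip addrA.
Qed.

Section winding.
Context {R : realType} (mu s : R).
Context (mu_far : forall a : R, pinch a -> 2 * s <= `|a - mu|).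
Implicit Types p q r : necklace R.

Definition beyond p : R := (mu <= pos p)%R%:R.

(* The signed number of crossings of the point mu of the upper half-line on a
   jump from p to q of length less than s; jumps between the two half-lines
   happen near pinch points, hence away from mu. *)
Definition winding p q : R :=
  if upper p && upper q then beyond q - beyond p else 0.

(** Both points lie within [2 * s] of [a], so [mu] cannot separate them. *)
Lemma beyond_near_pinch p q a : mdist p q < s -> pinch a -> `|pos p - a| < s ->
  beyond p = beyond q.
Proof.
move=> /(le_lt_trans (pos_dist _ _)) pq /mu_far + pa.
move: pq pa; rewrite /beyond !ltr_norml => /andP[? ?] /andP[? ?].
have [mp|mp] := leP mu (pos p); have [mq|mq] := leP mu (pos q) => //;
  by case: ger0P => *; exfalso; lra.
Qed.

Lemma beyond_cross p q r : mdist p q < s -> mdist p r < s ->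
  upper p != upper r -> beyond p = beyond q.
Proof.
move=> pq; rewrite necklace_mdistE /necklace_dist => + /negPf E.
rewrite E; have [a aP ->] := crossE (pos p) (pos r) => pr.
apply: (beyond_near_pinch pq aP); apply: le_lt_trans pr.
by rewrite lerDl.
Qed.

(** Differences telescope on the upper half-line. If just one vertex is lower, [beyond_cross] shows
    that the edge between the other two does not cross [mu]. *)
Lemma winding_triangle p q r : mdist p q < s -> mdist q r < s -> mdist p r < s ->
  winding p q + winding q r = winding p r.
Proof.
move=> pq qr pr; have qp : mdist q p < s by rewrite metric_sym.
have rq : mdist r q < s by rewrite metric_sym.
have A := beyond_cross pq pr; have B := beyond_cross pr pq.
have C := beyond_cross qr qp.
move: A B C; rewrite /winding.
case: (upper p) (upper q) (upper r) => -[] [] //= A B C; lra.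
Qed.

Lemma winding_eq0 p q : beyond p = beyond q -> winding p q = 0.
Proof. by rewrite /winding => ->; rewrite subrr if_same. Qed.

(** The flag of [mk false x] is raised only at pinch points, and those are far from [mu]. *)
Lemma winding_lower x y : 0 <= x -> 0 <= y -> `|x - y| < s ->
  winding (mk false x) (mk false y) = 0.
Proof.
move=> x0 y0 xy; have [ux|lx] := boolP (upper (mk false x)); last first.
  by rewrite /winding (negPf lx).
have xP : pinch x by move: ux => /= /asboolP; rewrite (max_idPr x0).
apply/winding_eq0/(beyond_near_pinch _ xP); first by rewrite mk_dist.
rewrite pos_mk// subrr normr0; exact: le_lt_trans (normr_ge0 _) xy.
Qed.

End winding.

(** * Absence of a coarse homotopy between the sheets *)

Lemma sheets_not_homotopic (R : realType) :
  ~ coarse_homotopic (@sheet R true) (sheet false).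
Proof.
move=> [q [[qc _] [H [[Hc Hp] Hfg]]]].
(* Heights of adjacent columns differ by less than [d], so neighbours in the truncated unit grid are
   less than [2 + d] apart. *)
have [d d0 qd] := qc 2 (ltr0n _ 2).
have [s' s'0 Hs'] := Hc (2 + d) (addr_gt0 (ltr0n _ 2) d0).
(* The summand 1 lets [s] exceed the unit steps along the lower half-line. *)
pose s := s' + 1.
have Hs p p' : mdist p p' < 2 + d -> mdist (H p) (H p') < s.
  by move=> /Hs'; rewrite /s; lra.
pose o : halfline R := to_halfline 0.
(* The column over 0 has length [hval (q o)], so [m] bounds its whole image. *)
have [m m0 Hm] := Hc (hval (q o) + 1) (ltr_wpDl (hval_ge0 _) ltr01).
have start t : pos (H (cyl q o t)) < m.
  have := Hm (cyl q o 0) (cyl q o t); rewrite (proj1 (Hfg o)).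
  have -> : sheet true o = mk true (0 : R) by rewrite /sheet /o to_halflineK.
  rewrite dist_origin; apply.
  rewrite cylinder_dist !cyl1 mdistxx cyl2 ?hval_ge0// sub0r normrN.
  rewrite ger0_norm ?hval_ge0// gt_max.
  have := cylinder_le (cyl q o t); rewrite cyl1; have := hval_ge0 (q o).
  by move=> ? ?; apply/andP; split; lra.
have [mu mmu mu_far] := far_from_pinch (2 * s) (m + 1).
have : mbounded [set p : necklace R | pos p <= mu].
  by apply/mbounded_necklace; exists mu.
move=> /Hp/(mbounded_cylinder _ qc)[T HT].
(* Past time [T] the columns are mapped beyond [mu]; the summand [mu] puts the upper half-line
   beyond [mu] at time [N]. *)
pose N := Num.bound (`|T| + mu).
have muN : `|T| + mu < N%:R by apply: archi_boundP; have := normr_ge0 T; lra.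
have [K' HK'] := halfline_bound qc N%:R.
pose K := Num.bound `|K'|.
have KK' : K' <= K%:R.
  by apply: le_trans (ler_norm _) _; apply/ltW/archi_boundP.
pose x (i : nat) : halfline R := to_halfline (i%:R).
have xE i : hval (x i) = i%:R by rewrite to_halflineK.
(* Since [cyl] truncates heights, each column becomes constant at its top, and the grid is a full
   rectangle whose row [K] is the lower half-line. *)
pose P i k := H (cyl q (x i) k%:R).
have cyl_height y t : 0 <= t ->
    hval (\val (cyl q y t)).2 = Num.min t (hval (q y)).
  by move=> t0; rewrite [LHS]to_halflineK// le_min t0 hval_ge0.
have Pstep i j k l : (i <= j <= i.+1)%N -> (k <= l <= k.+1)%N ->
    mdist (P i k) (P j l) < s.
  rewrite -!(ler_nat R) -!natr1 => /andP[ij ji] /andP[kl lk].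
  have xx : mdist (x i) (x j) < 2.
    by rewrite halfline_dist !xE ler0_norm; lra.
  have := qd _ _ xx; rewrite halfline_dist ltr_norml => /andP[qij qji].
  apply: Hs; rewrite cylinder_dist !cyl1 gt_max; apply/andP; split; first by lra.
  rewrite !cyl_height// ltr_norml.
  by case: (leP k%:R); case: (leP l%:R) => ? ?; apply/andP; split; lra.
have P0 i : P i 0%N = mk true i%:R.
  by rewrite /P (proj1 (Hfg (x i))) /sheet xE.
have PK i : (i <= N)%N -> P i K = mk false i%:R.
  rewrite -(ler_nat R) -(xE i) => /HK'/le_trans/(_ KK') qK.
  rewrite /P -/(sheet false (x i)) -(proj2 (Hfg (x i))); congr H.
  by apply: val_inj; rewrite /= minxx (min_idPr qK).
have := @grid_boundary R (necklace R) (winding mu) P N K.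
rewrite [X in X + _ = _]big1_seq; last first.
  move=> k _; apply: winding_eq0; rewrite /beyond.
  by rewrite !leNgt !(lt_trans (start _))//; lra.
rewrite [X in _ + X]big_nat big1; last first.
  move=> i /andP[_ iN]; rewrite !PK// 1?ltnW//.
  apply: (winding_lower mu_far) => //.
  by rewrite -natr1 ler0_norm /s; lra.
have far k : mu <= pos (P N k).
  rewrite leNgt; apply/negP => /ltW /(HT (cyl q (x N) k%:R)).
  rewrite cyl1 xE; have := ler_norm T; lra.
rewrite [X in _ = _ + X]big1_seq; last first.
  by move=> k _; apply: winding_eq0; rewrite /beyond !far.
under eq_bigr => i _ do rewrite !P0 /winding /=.
rewrite telescope_sumr// /beyond !pos_mk//.
have -> : mu <= N%:R by have := normr_ge0 T; lra.
have -> : (mu <= 0%:R) = false by apply/negbTE; rewrite -ltNge; lra.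
move=> contra; have : (0 : R) + 0 = 1 - 0 + 0; last by lra.
apply: contra => i k.
(* Both ways around a square have the winding of its diagonal. *)
by rewrite !(winding_triangle mu_far) ?Pstep ?leqnn ?leqnSn.
Qed.

Theorem corollary7p8 (R : realType) :
  exists X : pgeo R, ~ injective (@eta R X).
Proof.
exists necklace_pgeo => eta_inj; apply: (@sheets_not_homotopic R).
apply/(@pi0_classP _ (necklace R) (sheet_map true) (sheet_map false)).
by apply: eta_inj; rewrite !eta_class; apply/end_ofP/sheets_end_equiv.
Qed.
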